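(* Let $F[T]$ be the monoid defined in the context. For every finite alphabet $A$ representing a generating set for $F[T]$, there is a regular language $L \subseteq A^*$ such that every element of $F[T]$ is represented by exactly one word in $L$.
   Context: A finite alphabet $A$ represents a generating set for a monoid $M$ if there is a map $\phi : A \to M$ extending to a surjective homomorphism $A^* \to M$; the word $w$ represents the element $w\phi$. Construction $S[T]$: given a (right) action of a semigroup $S$ on a set $T$ (disjoint from $S$), $S[T]$ is the semigroup with carrier set $S \cup T$ in which multiplication in $S$ is unchanged and, for $s \in S$ and $x, y \in T$, $sx = x$, $xs = x \cdot s$, $xy = y$. The specific monoid $F[T]$: here $\mathbb{N} = \{1,2,3,\ldots\}$. Let $F$ and $F'$ be free monoids with bases $X = \{x,y\}$ and $X' = \{x',y'\}$ respectively. Let $R = \{w \in F' : |w|_{y'} \text{ is even}\}$, where $|w|_{y'}$ is the number of occurrences of $y'$ in $w$. Let $w_0, w_1, w_2, \ldots$ be the elements of $R$ enumerated in length-plus-lexicographic order (shorter words first; words of equal length ordered lexicographically with respect to a fixed ordering of $X'$), and define the bijection $\psi : \mathbb{N}\cup\{0\} \to R$ by $j\psi = w_j$. Let $P = \{p_i : i \in \mathbb{N}\}$, $Q = \{q_i : i \in \mathbb{N},\ i \text{ is not of the form } 2^j \text{ with } j \in \mathbb{N}\cup\{0\}\}$, and $T = P \cup Q \cup F' \cup \{\Omega\}$ (a disjoint union, with distinct $p_i$'s and distinct $q_i$'s). Let $F$ act on the right on $T$ via the unique action extending the following action of the generators $x,y$: $p_i \cdot x = p_{i+1}$; $p_i \cdot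 y = q_i$ if $i \neq 2^j$ for every $j \in \mathbb{N}\cup\{0\}$, and $p_i \cdot y = j\psi$ if $i = 2^j$; $q_i \cdot x = q_i \cdot y = \Omega$; $w \cdot x = wx'$ and $w \cdot y = wy'$ for $w \in F'$; $\Omega \cdot x = \Omega \cdot y = \Omega$. $F[T]$ is the monoid obtained from this action by the construction above; its identity is the identity of $F$. *)

(* Defs.v *)
From HB Require Import structures.
From mathcomp Require Import all_boot.

Set Implicit Arguments.
Unset Strict Implicit.
Unset Printing Implicit Defensive.

Local Open Scope group_scope.

Definition free (A : Type) := seq A.

HB.instance Definition _ (A : choiceType) := Choice.on (free A).
HB.instance Definition _ (A : choiceType) :=
  isMonoid.Build (free A) (@catA A) (@cat0s A) (@cats0 A).

(* [eval phi] is the homomorphism A^* -> M extending phi : A -> M. *)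
Definition eval (A : choiceType) (M : monoidType) (phi : A -> M)
  (w : free A) : M := \big[*%g/1]_(a <- w) phi a.

Lemma eval_morphism (A : choiceType) (M : monoidType) (phi : A -> M) :
  monoid_morphism (eval phi).
Proof. by split=> [|u v]; rewrite /eval ?big_nil ?big_cat. Qed.

HB.instance Definition _ (A : choiceType) (M : monoidType) (phi : A -> M) :=
  isUMagmaMorphism.Build (free A) M (eval phi) (eval_morphism phi).

Lemma eval1 (A : choiceType) (M : monoidType) (phi : A -> M) (a : A) :
  eval phi [:: a] = phi a.
Proof. by rewrite /eval big_seq1. Qed.

Definition represents_generating_set (A : finType) (M : monoidType)
  (phi : A -> M) : Prop := forall m : M, exists w : free A, eval phi w = m.

Record dfa (A : finType) := Dfa {
  dfa_state : finType;
  dfa_init : dfa_state;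
  dfa_trans : dfa_state -> A -> dfa_state;
  dfa_final : {set dfa_state}
}.

Definition dfa_accepts (A : finType) (D : dfa A) (w : free A) : bool :=
  foldl (@dfa_trans A D) (dfa_init D) w \in dfa_final D.

Definition regular (A : finType) (L : pred (free A)) : Prop :=
  exists D : dfa A, forall w : free A, (w \in L) = dfa_accepts D w.

Record semigroup_action (S : semigroupType) (T : Type) := SemigroupAction {
  sact :> T -> S -> T;
  sactM : forall t s s', sact t (s * s') = sact (sact t s) s'
}.

(* The construction S[T]. *)
Section SemigroupExtension.
Variables (S : semigroupType) (T : choiceType) (act : semigroup_action S T).

Definition sg_ext of semigroup_action S T : Type := (S + T)%type.

Definition sg_ext_mul (u v : sg_ext act) : sg_ext act :=
  match u, v with
  | inl s, inl s' => inl (s * s')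
  | inl _, inr t => inr t
  | inr t, inl s => inr (act t s)
  | inr _, inr t => inr t
  end.

Lemma sg_ext_mulA : associative sg_ext_mul.
Proof. by move=> [s|t] [s'|t'] [s''|t''] //=; rewrite ?mulgA ?sactM. Qed.

HB.instance Definition _ := Choice.copy (sg_ext act) (S + T)%type.
HB.instance Definition _ := isSemigroup.Build (sg_ext act) sg_ext_mulA.
End SemigroupExtension.

Variant X := lx | ly.
Variant X' := lx' | ly'.

Definition X_bool (a : X) : bool := if a is ly then true else false.
Definition bool_X (b : bool) : X := if b then ly else lx.
Lemma X_boolK : cancel X_bool bool_X. Proof. by case. Qed.
HB.instance Definition _ := Finite.copy X (can_type X_boolK).

Definition X'_bool (a : X') : bool := if a is ly' then true else false.
Definition bool_X' (b : bool) : X' := if b then ly' else lx'.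
Lemma X'_boolK : cancel X'_bool bool_X'. Proof. by case. Qed.
HB.instance Definition _ := Finite.copy X' (can_type X'_boolK).

Definition R : pred (free X') := [pred w | ~~ odd (count_mem ly' w)].

(* Strict lexicographic comparison; only used on words of equal length. *)
Fixpoint lex_lt (r : rel X') (u v : seq X') : bool :=
  match u, v with
  | a :: u', b :: v' => if a == b then lex_lt r u' v' else r a b
  | _, _ => false
  end.

Definition shortlex_lt (r : rel X') (u v : free X') : bool :=
  (size u < size v) || ((size u == size v) && lex_lt r u v).

Section Psi.
Variable r : rel X'.

(* The words of length n, in lexicographic order. *)
Fixpoint words (n : nat) : seq (free X') :=
  if n is n'.+1 then [seq a :: w | a <- sort r [:: lx'; ly'], w <- words n']
  else [:: [::]].

Definition R_words_below (n : nat) : seq (free X') :=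
  flatten [seq [seq w <- words m | w \in R] | m <- iota 0 n].

(* R contains a word of every length, so the (j+1)-st element of R has length
   at most j; see psi_R, psi_shortlex and psi_surj. *)
Definition psi (j : nat) : free X' := nth [::] (R_words_below j.+1) j.

Lemma R_words_belowS n :
  R_words_below n.+1 = R_words_below n ++ [seq w <- words n | w \in R].
Proof. by rewrite /R_words_below -addn1 iotaD map_cat flatten_cat /= cats0. Qed.

Lemma mem_words n w : (w \in words n) = (size w == n).
Proof.
elim: n w => [|n IHn] w; first by case: w.
have letters a : a \in sort r [:: lx'; ly'] by rewrite mem_sort; case: a.
apply/allpairsP/idP => [[[a u] [_ /=]]|].
  by rewrite IHn => /eqP <- ->.
by case: w => // a w; rewrite eqSS -IHn => ww; exists (a, w).
Qed.

Lemma size_R_words_below n : n <= size (R_words_below n).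
Proof.
elim: n => // n IHn; rewrite R_words_belowS size_cat -addn1 leq_add //.
rewrite -has_predT; apply/hasP; exists (nseq n lx') => //.
by rewrite mem_filter mem_words size_nseq eqxx andbT inE count_nseq.
Qed.

Lemma mem_R_words_below n w :
  (w \in R_words_below n) = (size w < n) && (w \in R).
Proof.
elim: n => // n IHn; rewrite R_words_belowS mem_cat IHn mem_filter mem_words.
by rewrite ltnS [in RHS]leq_eqVlt; case: eqP; case: (w \in R);
  rewrite ?andbT ?andbF ?orbT ?orbF.
Qed.

Lemma nth_R_words_below n m j : n <= m -> j < size (R_words_below n) ->
  nth [::] (R_words_below m) j = nth [::] (R_words_below n) j.
Proof.
move=> /subnKC <-; elim: (m - n) => [|k IHk] lt_j; first by rewrite addn0.
rewrite addnS R_words_belowS nth_cat IHk //; case: ltnP => //.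
rewrite leqNgt (leq_trans lt_j) //; elim: k {IHk} => [|k IHk].
  by rewrite addn0.
by rewrite addnS R_words_belowS size_cat (leq_trans IHk) ?leq_addr.
Qed.

Lemma psi_nth n j : j < size (R_words_below n) ->
  psi j = nth [::] (R_words_below n) j.
Proof.
move=> lt_j; have [le_n|/ltnW le_n] := leqP n j.+1.
  by rewrite /psi (nth_R_words_below le_n).
by rewrite (nth_R_words_below le_n) // (leq_trans _ (size_R_words_below _)).
Qed.

Lemma psi_R j : psi j \in R.
Proof.
have /(mem_nth [::]) := size_R_words_below j.+1.
by rewrite mem_R_words_below => /andP[].
Qed.

Lemma psi_surj w : w \in R -> exists j, psi j = w.
Proof.
move=> Rw; have ww : w \in R_words_below (size w).+1.
  by rewrite mem_R_words_below ltnSn.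
exists (index w (R_words_below (size w).+1)).
by rewrite (@psi_nth (size w).+1) ?index_mem // nth_index.
Qed.

Hypotheses (r_total : total r) (r_anti : antisymmetric r)
  (r_trans : transitive r).

Lemma pairwise_words n : pairwise (lex_lt r) (words n).
Proof.
elim: n => //= n IHn.
have: pairwise (fun a b => (a != b) && r a b) (sort r [:: lx'; ly']).
  rewrite (@pairwise_relI _ (fun a b => a != b)) -uniq_pairwise sort_uniq /=.
  by rewrite -(sorted_pairwise r_trans) sort_sorted.
elim: (sort _ _) => //= a s IHs /andP[a_s /IHs s_lt].
rewrite pairwise_cat s_lt andbT pairwise_map; apply/andP; split; last first.
  by apply: sub_pairwise IHn => u v /=; rewrite eqxx.
apply/allrelP => _ _ /mapP[u _ ->] /allpairsP[[b v] [/= bs _ ->]] /=.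
by have /andP[/negPf-> ->] := allP a_s b bs.
Qed.

Lemma pairwise_R_words_below n : pairwise (shortlex_lt r) (R_words_below n).
Proof.
elim: n => // n IHn; rewrite R_words_belowS pairwise_cat IHn /=.
apply/andP; split.
  apply/allrelP => u v; rewrite mem_R_words_below mem_filter mem_words.
  by move=> /andP[lt_u _] /andP[_ /eqP sz_v]; rewrite /shortlex_lt sz_v lt_u.
have: all (fun w => size w == n) [seq w <- words n | w \in R].
  by apply/allP => w; rewrite mem_filter mem_words => /andP[].
have := subseq_pairwise (filter_subseq (mem R) _) (pairwise_words n).
elim: [seq w <- _ | _] => //= u s IHs /andP[u_s s_lt] /andP[/eqP sz_u sz_s].
rewrite IHs // andbT; apply/allP => v vs; rewrite /shortlex_lt sz_u.
by rewrite (eqP (allP sz_s v vs)) eqxx (allP u_s) ?orbT.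
Qed.

Lemma psi_shortlex i j : i < j -> shortlex_lt r (psi i) (psi j).
Proof.
move=> lt_ij; have lt_j := size_R_words_below j.+1.
rewrite (@psi_nth j.+1 i) ?(ltn_trans lt_ij) // (@psi_nth j.+1 j) //.
by apply: (pairwiseP [::] (pairwise_R_words_below _)) => //;
  rewrite inE (ltn_trans lt_ij).
Qed.

Lemma shortlex_lt_irr w : shortlex_lt r w w = false.
Proof. by rewrite /shortlex_lt ltnn eqxx /=; elim: w => //= a w; rewrite eqxx. Qed.

Lemma psi_inj : injective psi.
Proof.
by move=> i j; have [||//] := ltngtP i j => /psi_shortlex + eq_ij;
  rewrite eq_ij shortlex_lt_irr.
Qed.

End Psi.

Definition is_pow2 (i : nat) : bool := [exists j : 'I_i.+1, (i == 2 ^ j)%N].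

Lemma is_pow2P i : reflect (exists j : nat, i = (2 ^ j)%N) (is_pow2 i).
Proof.
apply: (iffP existsP) => [[j /eqP ->]|[j ->]]; first by exists j.
have lt_j : j < (2 ^ j)%N.+1 by rewrite ltnS ltnW // ltn_expl.
by exists (Ordinal lt_j).
Qed.

Definition pidx := {i : nat | 0 < i}.
Definition qidx := {i : nat | (0 < i) && ~~ is_pow2 i}.

Variant T := tP of pidx | tQ of qidx | tW of free X' | tOmega.

Definition T_sum (t : T) : pidx + qidx + free X' + unit :=
  match t with
  | tP i => inl (inl (inl i))
  | tQ i => inl (inl (inr i))
  | tW w => inl (inr w)
  | tOmega => inr tt
  end.
Definition sum_T (t : pidx + qidx + free X' + unit) : T :=
  match t with
  | inl (inl (inl i)) => tP i
  | inl (inl (inr i)) => tQ i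
  | inl (inr w) => tW w
  | inr _ => tOmega
  end.
Lemma T_sumK : cancel T_sum sum_T. Proof. by case. Qed.
HB.instance Definition _ := Choice.copy T (can_type T_sumK).

Definition pidx_succ (i : pidx) : pidx := exist _ (val i).+1 (ltn0Sn (val i)).

(* [insub (val i) : option qidx] is [Some] exactly when i is not a power of 2;
   otherwise i = 2 ^ j with j = trunc_log 2 i. *)
Definition step (r : rel X') (t : T) (a : X) : T :=
  match t, a with
  | tP i, lx => tP (pidx_succ i)
  | tP i, ly =>
      if insub (val i) is Some q then tQ q
      else tW (psi r (trunc_log 2 (val i)))
  | tQ _, _ => tOmega
  | tW w, lx => tW (rcons w lx')
  | tW w, ly => tW (rcons w ly')
  | tOmega, _ => tOmega
  end.

Lemma step_p_pow2 r (i : pidx) j :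
  val i = (2 ^ j)%N -> step r (tP i) ly = tW (psi r j).
Proof.
move=> def_i /=; rewrite insubF ?def_i ?trunc_expnK // expn_gt0 /=.
by apply/negbF/is_pow2P; exists j.
Qed.

Lemma step_p_nonpow2 r (i : pidx) (q : qidx) :
  val i = val q -> step r (tP i) ly = tQ q.
Proof. by move=> def_i /=; rewrite def_i valK. Qed.

Section FT.
Variable r : rel X'.

Lemma stepsM (t : T) (u v : free X) :
  foldl (step r) t (u * v) = foldl (step r) (foldl (step r) t u) v.
Proof. exact: foldl_cat. Qed.

Definition F_action : semigroup_action (free X) T :=
  @SemigroupAction (free X) T (foldl (step r)) stepsM.

Definition FT : Type := sg_ext F_action.

HB.instance Definition _ := Semigroup.on FT.

Lemma FT_mul1g : left_id (inl (1 : free X) : FT) *%g.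
Proof. by case. Qed.
Lemma FT_mulg1 : right_id (inl (1 : free X) : FT) *%g.
Proof. by case=> [w|t] //; congr inl; apply: mulg1. Qed.

HB.instance Definition _ := Semigroup_isMonoid.Build FT FT_mul1g FT_mulg1.
End FT.

(* Main.v *)
Require Import Defs.
From mathcomp Require Import all_boot.

(** Since x, y and p_1 are not products of other elements, every generating
    alphabet has letters for them; all representatives are words in these three
    letters. Neither Q nor R has an evident regular set of representatives, but
    p_1 x^i y is q_(i+1) or an element of R, and every element of Q and of R
    arises for exactly one i; hence p_1 x^* y represents the union of Q and R.
    The rest is regular: F is {x, y}^*, P is p_1 x^*, the complement of R in F'
    is p_1 y u with u having an odd number of y's (as p_1 y is the empty word of
    F'), and Omega is p_1 x x y x. *)

Set Implicit Arguments.
Unset Strict Implicit.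
Unset Printing Implicit Defensive.

(** * Closure properties of regular languages *)

Definition recognizable (A : finType) (P : free A -> Prop) : Prop :=
  exists D : dfa A, forall w, dfa_accepts D w <-> P w.

Lemma recognizable_ext (A : finType) (P P' : free A -> Prop) :
  (forall w, P w <-> P' w) -> recognizable P -> recognizable P'.
Proof. by move=> PP' [D DP]; exists D => w; apply: iff_trans (PP' w). Qed.

Lemma recognizableT (A : finType) : recognizable (fun _ : free A => True).
Proof.
by exists (Dfa tt (fun _ (_ : A) => tt) setT) => w; rewrite /dfa_accepts inE.
Qed.

Lemma recognizable_nil (A : finType) :
  recognizable (fun w : free A => w = [::]).
Proof.
exists (Dfa true (fun _ (_ : A) => false) [set true]) => w.
rewrite /dfa_accepts inE; case: w => //= b w.
by have -> : foldl (fun=> xpred0) false w = false by elim: w.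
Qed.

Lemma recognizableU (A : finType) (P P' : free A -> Prop) :
  recognizable P -> recognizable P' -> recognizable (fun w => P w \/ P' w).
Proof.
move=> [[S i d f] DP] [[S' i' d' f'] DP'].
exists (Dfa (i, i') (fun s (a : A) => (d s.1 a, d' s.2 a))
            [set s | (s.1 \in f) || (s.2 \in f')]) => w.
apply: iff_trans (or_iff_compat_l _ (DP' w)).
apply: iff_trans (or_iff_compat_r _ (DP w)).
rewrite /dfa_accepts inE /=.
have -> : foldl (fun s a => (d s.1 a, d' s.2 a)) (i, i') w
  = (foldl d i w, foldl d' i' w).
  by elim: w i i' {DP DP'} => //= a w IHw i i'; rewrite IHw.
by split=> /orP.
Qed.

Lemma recognizable_cons (A : finType) (a : A) (P : free A -> Prop) :
  recognizable P -> recognizable (fun w => exists2 v, w = a :: v & P v).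
Proof.
move=> [[S i d f] DP].
(* [None] is the start, [Some None] the sink after a wrong first letter, and [Some (Some s)] runs
   the given automaton. *)
pose d' (s : option (option S)) b :=
  match s with
  | None => Some (if b == a then Some i else None)
  | Some s' => Some (omap (d^~ b) s')
  end.
exists (Dfa None d' [set Some (Some s) | s in f]) => w.
have run s v : foldl d' (Some (Some s)) v = Some (Some (foldl d s v)).
  by elim: v s => //= b v IHv s; rewrite IHv.
have dead v : foldl d' (Some None) v = Some None by elim: v.
rewrite /dfa_accepts /=; split=> [|[v -> /DP]].
  case: w => [/imsetP[]//|b w /=]; case: eqP => [->|_].
    rewrite run => /imsetP[s fs [eq_s]]; exists w => //.
    by apply/DP; rewrite /dfa_accepts /= eq_s.
  by rewrite dead => /imsetP[].
by rewrite /= eqxx run => fv; apply/imsetP; exists (foldl d i v).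
Qed.

Lemma recognizable_map (A B : finType) (h : A -> B) (P : free A -> Prop) :
  injective h -> recognizable P ->
  recognizable (fun w => exists2 v, w = map h v & P v).
Proof.
move=> inj_h [[S i d f] DP].
pose d' (s : option S) b :=
  if s is Some s' then omap (d s') [pick a | h a == b] else None.
exists (Dfa (Some i) d' [set Some s | s in f]) => w.
have run s v : foldl d' (Some s) (map h v) = Some (foldl d s v).
  (* Injectivity of [h] makes [pick] return the very letter that was mapped. *)
  elim: v s => //= a v IHv s; case: pickP => [a' /eqP/inj_h ->|/(_ a)] //=.
  by rewrite eqxx.
have dead v : foldl d' None v = None by elim: v.
rewrite /dfa_accepts /=; split=> [|[v -> /DP]]; last first.
  by rewrite run => fv; apply/imsetP; exists (foldl d i v).
move=> acc_w.
have [v def_w] : exists v, w = map h v.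
  elim: w (i) acc_w {DP} => [|b w IHw] s /=; first by exists [::].
  case: pickP => [a /eqP <- /IHw[v ->]|_]; first by exists (a :: v).
  by rewrite dead => /imsetP[].
exists v => //; apply/DP; rewrite /dfa_accepts /=.
by move: acc_w; rewrite def_w run => /imsetP[s fs [->]].
Qed.

Lemma recognizable_odd_count (A : finType) (a : A) :
  recognizable (fun w : free A => odd (count_mem a w)).
Proof.
exists (Dfa false (fun s b => (b == a) (+) s) [set true]) => w.
rewrite /dfa_accepts inE /= eqb_id.
suff -> : foldl (fun s b => (b == a) (+) s) false w = odd (count_mem a w) by [].
(* The added [false] stands for the start state, over which the induction generalizes. *)
rewrite -[RHS]addbF; elim: w false => //= b w IHw s.
by rewrite IHw oddD oddb addbCA addbA.
Qed.

Lemma recognizable_nseq_rcons (A : finType) (a b : A) : a != b ->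
  recognizable
    (fun w => exists i, w = nseq i a \/ w = rcons (nseq i a) b).
Proof.
move=> neq_ab.
(* [Some true]: only [a] read so far; [Some false]: one closing [b] read; [None]: sink. *)
pose d (s : option bool) c :=
  if s is Some true then
    if c == a then Some true else if c == b then Some false else None
  else None.
exists (Dfa (Some true) d [set Some true; Some false]) => w.
have dead v : foldl d None v = None by elim: v.
rewrite /dfa_accepts /=; split; last first.
  have run i v : foldl d (Some true) (nseq i a ++ v) = foldl d (Some true) v.
    by elim: i => //= i IHi; rewrite eqxx.
  case=> i [|] ->; last by rewrite -cats1 run /= eq_sym (negPf neq_ab) eqxx !inE.
  by move: (run i [::]); rewrite cats0 => ->; rewrite !inE.
elim: w => [_|c w IHw /=]; first by exists 0; left.
case: eqP => [-> /IHw[i [->|->]]|_]; [by exists i.+1; left|by exists i.+1; right|].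
case: eqP => [->|_]; last by rewrite dead !inE.
by case: w {IHw} => [|e w] /=; [exists 0; right|rewrite dead !inE].
Qed.

(** Peeling letters off a word for [m], either some letter equals [m] or the empty word is reached,
    which would give [m = 1]. *)
Lemma irreducible_letter (A : finType) (M : monoidType) (phi : A -> M) (m : M) :
  represents_generating_set phi -> m <> 1%g ->
  (forall u v, (u * v)%g = m -> u = m \/ v = m) -> exists a, phi a = m.
Proof.
move=> /(_ m)[w +] m_neq1 m_irr; rewrite /eval.
elim: w => [|a w IHw]; rewrite ?big_nil ?big_cons; first by move/esym.
by case/m_irr => [|/IHw //]; exists a.
Qed.

(** * The action of F on T, starting from p_1 *)

Definition prime_letter (a : X) : X' := if a is ly then ly' else lx'.
Definition unprime_letter (a : X') : X := if a is ly' then ly else lx.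

Lemma prime_letterK : cancel prime_letter unprime_letter. Proof. by case. Qed.
Lemma unprime_letterK : cancel unprime_letter prime_letter. Proof. by case. Qed.

Lemma count_prime u : count_mem ly' (map prime_letter u) = count_mem ly u.
Proof. by rewrite count_map; apply: eq_count => -[]. Qed.

Definition p1 : pidx := exist _ 1 (ltn0Sn 0).

(** The letter x raises the index of p_i to at least 2, and no other step ends in P. *)
Lemma step_neq_p1 r t a : step r t a <> tP p1.
Proof.
case: t a => [[[|i] i_gt0]|q|w|] [] //= []; by case: insubP.
Qed.

Lemma foldl_step_p1 r t u : foldl (step r) t u = tP p1 -> t = tP p1.
Proof. by elim/last_ind: u => // u a _; rewrite foldl_rcons => /step_neq_p1. Qed.

Lemma foldl_step_tW r w u :
  foldl (step r) (tW w) u = tW (w ++ map prime_letter u).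
Proof.
elim: u w => [|a u IHu] w; first by rewrite cats0.
by rewrite -cat_rcons -IHu /=; case: a.
Qed.

Lemma val_iter_pidx_succ i p : val (iter i pidx_succ p) = i + val p.
Proof. by elim: i => //= i ->. Qed.

Lemma foldl_step_nseq_lx r p i :
  foldl (step r) (tP p) (nseq i lx) = tP (iter i pidx_succ p).
Proof. by elim: i p => // i IHi p; rewrite iterSr -IHi. Qed.

(** Here 1 = 2^0, and [psi r 0] computes to the empty word for any [r]. *)
Lemma step_p1_ly r : step r (tP p1) ly = tW [::].
Proof. by rewrite (@step_p_pow2 _ _ 0). Qed.

Lemma foldl_step_p1_ly r u :
  foldl (step r) (tP p1) (ly :: u) = tW (map prime_letter u).
Proof.
rewrite -[foldl _ _ _]/(foldl (step r) (step r (tP p1) ly) u).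
by rewrite step_p1_ly foldl_step_tW.
Qed.

(* The words v such that p_1 v is the chosen representative of some element
   of T. *)
Definition T_rep (v : free X) : Prop :=
  (exists i, v = nseq i lx \/ v = rcons (nseq i lx) ly)
  \/ (exists2 u, v = ly :: u & odd (count_mem ly u))
  \/ v = [:: lx; lx; ly; lx].

Lemma recognizable_T_rep : recognizable T_rep.
Proof.
apply: recognizableU; first exact: recognizable_nseq_rcons.
apply: recognizableU; first exact/recognizable_cons/recognizable_odd_count.
have rec := recognizable_cons _ (recognizable_nil X).
apply: recognizable_ext
  (recognizable_cons lx (recognizable_cons lx (recognizable_cons ly (rec lx)))).
move=> w; split=> [[_ -> [_ -> [_ -> [_ -> ->]]]] //|->].
by do 4![eexists; first by []].
Qed.

(** * The bijection between T and its representatives *)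

Section Representatives.
Variable r : rel X'.
Hypotheses (r_total : total r) (r_trans : transitive r).

(** Meaningful only for [w] in [R]; for other words [index] returns the length of the list. *)
Definition psi_inv (w : free X') : nat := index w (R_words_below r (size w).+1).

Lemma psi_invK w : w \in R -> psi r (psi_inv w) = w.
Proof.
move=> Rw; have ww : w \in R_words_below r (size w).+1.
  by rewrite mem_R_words_below ltnSn.
by rewrite (@psi_nth _ (size w).+1) ?index_mem // nth_index.
Qed.

Lemma psiK : cancel (psi r) psi_inv.
Proof.
by move=> j; apply: (psi_inj r_total r_trans); rewrite psi_invK ?psi_R.
Qed.

(** The exponents are predecessors because p_i = p_1 x^(i-1). For Omega, the prefix x x y leads to
    q_3, 3 being the least index in Q. *)
Definition rep_of (t : T) : free X :=
  match t with
  | tP i => nseq (val i).-1 lx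
  | tQ i => rcons (nseq (val i).-1 lx) ly
  | tW w => if w \in R then rcons (nseq (2 ^ psi_inv w).-1 lx) ly
            else ly :: map unprime_letter w
  | tOmega => [:: lx; lx; ly; lx]
  end.

Lemma T_rep_rep_of t : T_rep (rep_of t).
Proof.
case: t => [i|i|w|] /=; last by right; right.
- by left; eexists; left.
- by left; eexists; right.
case: ifP => [_|/negbT]; first by left; eexists; right.
move=> w_odd; right; left; eexists; first by [].
by rewrite -count_prime (mapK unprime_letterK); move: w_odd; rewrite inE negbK.
Qed.

Lemma rep_ofK : cancel rep_of (foldl (step r) (tP p1)).
Proof.
have val_p1 n : 0 < n -> val (iter n.-1 pidx_succ p1) = n.
  by move=> n_gt0; rewrite val_iter_pidx_succ addn1 prednK.
case=> [i|i|w|] /=; rewrite ?foldl_rcons ?foldl_step_nseq_lx.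
- by congr tP; apply: val_inj; rewrite /= val_p1 ?(valP i).
- by apply: step_p_nonpow2; rewrite val_p1 //; case/andP: (valP i).
- case: ifP => Rw; last by rewrite foldl_step_p1_ly (mapK unprime_letterK).
  rewrite foldl_rcons foldl_step_nseq_lx (@step_p_pow2 _ _ (psi_inv w)).
    by rewrite psi_invK.
  by rewrite val_p1 ?expn_gt0.
(* The index 3 is not a power of 2, being odd and different from 1. *)
- case: insubP => // /negP[] /=; apply/is_pow2P => -[[|j]] //.
  by move/(congr1 odd); rewrite expnS oddM.
Qed.

Lemma T_repK v : T_rep v -> rep_of (foldl (step r) (tP p1) v) = v.
Proof.
case=> [[i]|[[u -> u_odd]|->]].
- have val_i : val (iter i pidx_succ p1) = i.+1.
    by rewrite val_iter_pidx_succ addn1.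
  case=> ->; rewrite ?foldl_rcons foldl_step_nseq_lx.
    by rewrite /rep_of val_i.
  (* Whether [i.+1] is a power of 2 decides between R and Q; the index is recovered from R by
     [psiK], and from Q directly. *)
  have [/is_pow2P[j def_i]|i_npow] := boolP (is_pow2 i.+1).
    rewrite (@step_p_pow2 _ _ j) ?val_i // /rep_of psi_R psiK.
    by rewrite -def_i.
  pose q : qidx := exist (fun n => (0 < n) && ~~ is_pow2 n) i.+1 i_npow.
  by rewrite (@step_p_nonpow2 _ _ q).
(* An odd count puts the word outside [R], so this family cannot clash with p_1 x^* y. *)
- rewrite foldl_step_p1_ly /= inE count_prime u_odd.
  by rewrite (mapK prime_letterK).
- by rewrite -[_ :: _]/(rep_of tOmega) rep_ofK.
Qed.

End Representatives.

(** * Letters for x, y and p_1, and evaluation of words in them *)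

Lemma FT_letter_F (r : rel X') (A : finType) (phi : A -> FT r) :
  represents_generating_set phi ->
  forall b : X, exists a, phi a = inl [:: b].
Proof.
move=> gen b; apply: irreducible_letter => // -[u|s] [v|t] //= [].
(* A one-letter word factors in F only with an empty factor. *)
case: u => [|c [|d u]] //=.
  by right; congr inl.
by case: v => //; left; congr inl.
Qed.

(** A product with right factor in T equals that factor; a product t s with s in F is handled by
    [foldl_step_p1]. *)
Lemma FT_letter_p1 (r : rel X') (A : finType) (phi : A -> FT r) :
  represents_generating_set phi -> exists a, phi a = inr (tP p1).
Proof.
move=> gen; apply: irreducible_letter => // -[u|s] [v|t] //= [].
- by right; congr inr.
- by move/foldl_step_p1; left; congr inr.
- by right; congr inr.
Qed.

Section Eval.
Variables (r : rel X') (A : finType) (phi : A -> FT r) (h : X -> A).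
Hypothesis phi_h : forall b, phi (h b) = inl [:: b].

Lemma eval_map_letters u : eval phi (map h u) = inl u.
Proof.
rewrite /eval; elim: u => [|b u IHu] /=; first by rewrite big_nil.
by rewrite big_cons IHu phi_h.
Qed.

Lemma eval_cons_letters a t u :
  phi a = inr t -> eval phi (a :: map h u) = inr (foldl (step r) t u).
Proof.
move=> phi_a; rewrite /eval big_cons phi_a.
by have := eval_map_letters u; rewrite /eval => ->.
Qed.

End Eval.

Theorem proposition6p2 (r : rel X')
  (r_total : total r) (r_anti : antisymmetric r) (r_trans : transitive r)
  (A : finType) (phi : A -> FT r) (gen : represents_generating_set phi) :
  exists L : pred (free A),
    regular L /\
    forall m : FT r, exists! w : free A, w \in L /\ eval phi w = m.
Proof.
have [ax phi_x] := FT_letter_F gen lx; have [ay phi_y] := FT_letter_F gen ly.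
have [ap phi_p] := FT_letter_p1 gen.
pose h b := if b is ly then ay else ax.
have phi_h b : phi (h b) = inl [:: b] by case: b.
have inj_h : injective h.
  by move=> b c /(congr1 phi); rewrite !phi_h => -[].
(* The first language represents F, the second T. *)
have [D accD] := recognizableU (recognizable_map inj_h (recognizableT X))
  (recognizable_cons ap (recognizable_map inj_h recognizable_T_rep)).
exists (dfa_accepts D); split=> [|m]; first by exists D.
pose nf (m : FT r) : free A :=
  match m with
  | inl u => map h u
  | inr t => ap :: map h (rep_of r t)
  end.
exists (nf m); split.
  split; last first.
    case: m => [u|t]; first exact: eval_map_letters.
    by rewrite /= (eval_cons_letters phi_h _ phi_p) rep_ofK.
  apply/accD; case: m => [u|t]; [by left; exists u|right].
  exists (map h (rep_of r t)) => //.
  by exists (rep_of r t); last exact: T_rep_rep_of.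
(* Uniqueness: every accepted word is the normal form [nf] of its own value. *)
move=> w [/accD w_in <-].
case: w_in => [[u -> _]|[_ -> [v -> /T_repK v_rep]]].
  by rewrite eval_map_letters.
by rewrite (eval_cons_letters phi_h _ phi_p) /= v_rep.
Qed.
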